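(* Let $p$ be an odd prime and $N\ge1$ an integer. Suppose $A\subset\{0,\ldots,N-1\}$ contains $0$, is $p$-free modulo $N$, and every $x\in\{0,\ldots,N-1\}\setminus A$ is $p$-covered by $A$ modulo $N$. Then $$S_p(A)=A+N\cdot S_p(0).$$ More generally, if $\alpha\in\mathbb{N}$ satisfies $\gcd(\alpha,N)=1$, then $$\alpha\cdot A+N\cdot S_p(0)$$ is a modular $p$-Stanley sequence modulo $p^\ell\cdot N$ for some integer $\ell\ge0$.
   Context: Let $p$ be an odd prime. A set of integers is $p$-free if it contains no $p$-term arithmetic progression with nonzero common difference. For a finite $p$-free set $A=\{a_0<\cdots<a_k\}$ of nonnegative integers, the $p$-Stanley sequence $S_p(A)=(a_n)_{n\ge0}$ is defined greedily: once $a_0<\cdots<a_n$ (with $n\ge k$) are defined, $a_{n+1}$ is the smallest integer greater than $a_n$ such that $\{a_0,\ldots,a_{n+1}\}$ is $p$-free. $S_p(A)$ is also regarded as a set, and $S_p(0)$ means $S_p(\{0\})$. A $p$-term arithmetic progression modulo $N$ is a list $x_1,\ldots,x_p$ of integers with $x_{i+1}-x_i\equiv d\pmod N$ for all $1\le i<p$, for some fixed $d$. For $A\subseteq\{0,\ldots,N-1\}$: $A$ is $p$-free modulo $N$ if it contains no $p$-term arithmetic progression modulo $N$ other than constant ones; an integer $x$ is $p$-covered by $A$ modulo $N$ if there exist $x_1<\cdots<x_{p-1}$ in $A$ such that $x_1,\ldots,x_{p-1},x$ form a $p$-term arithmetic progression modulo $N$. $A$ is a modular $p$-free set modulo $N$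 if $0\in A\subseteq\{0,\ldots,N-1\}$, $A$ is $p$-free modulo $N$, and every $x\in\{0,\ldots,N-1\}\setminus A$ is $p$-covered by $A$ modulo $N$. A sequence (viewed as a set, listed in increasing order) is a modular $p$-Stanley sequence modulo $N$ if it equals $S_p(A)$ for some modular $p$-free set $A$ modulo $N$. Notation: $X+Y=\{x+y\mid x\in X,\ y\in Y\}$ and $c\cdot X=\{cx\mid x\in X\}$. $\mathbb{N}$ denotes the positive integers. *)

(* Defs.v *)
From HB Require Import structures.
From mathcomp Require Import all_boot all_order all_algebra.
From mathcomp Require Import finmap boolp classical_sets zify.

Set Implicit Arguments.
Unset Strict Implicit.
Unset Printing Implicit Defensive.

Local Open Scope classical_set_scope.

Definition is_ap (d : int) (s : seq nat) : Prop :=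
  forall i, i.+1 < size s ->
    ((nth 0 s i.+1)%:Z - (nth 0 s i)%:Z)%R = d.

(* The terms may repeat and may decrease: only their differences modulo [N]
   matter. *)
Definition is_ap_mod (N : nat) (s : seq nat) : Prop :=
  exists d : int, forall i, i.+1 < size s ->
    (((nth 0 s i.+1)%:Z - (nth 0 s i)%:Z)%R = d %[mod N])%Z.

Definition p_free (p : nat) (A : set nat) : Prop :=
  forall (s : seq nat) (d : int),
    size s = p -> (forall x, x \in s -> A x) -> is_ap d s -> d = 0%R.

Definition p_free_mod (p N : nat) (A : {fset nat}) : Prop :=
  forall s : seq nat,
    size s = p -> {subset s <= A} -> is_ap_mod N s -> constant s.

Definition p_covered_mod (p N : nat) (A : {fset nat}) (x : nat) : Prop :=
  exists s : seq nat,
    [/\ size s = p.-1, sorted ltn s, {subset s <= A}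
      & is_ap_mod N (rcons s x)].

Definition modular_p_free_set (p N : nat) (A : {fset nat}) : Prop :=
  [/\ 0 \in A, {in A, forall a, a < N}, p_free_mod p N A
    & forall x, x < N -> x \notin A -> p_covered_mod p N A x].

(* The value is 0 when no natural number satisfies [P]; by [stanleyP] below
   this never happens in the construction of a Stanley sequence. *)
Definition least (P : nat -> Prop) : nat :=
  xget 0 [set n | P n /\ forall m, P m -> n <= m].

(* The first [n] terms of the sequence: the elements of [A] in increasing
   order, then the greedily chosen ones. *)
Fixpoint stanley_prefix (p : nat) (A : {fset nat}) (n : nat) : seq nat :=
  if n is m.+1 then
    let s := stanley_prefix p A m in
    rcons s (if m < #|` A| then nth 0 (sort leq A) m
             else least (fun x => last 0 s < x /\ p_free p [set` rcons s x]))
  else [::].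

Definition stanley (p : nat) (A : {fset nat}) (n : nat) : nat :=
  last 0 (stanley_prefix p A n.+1).

Definition stanley_set (p : nat) (A : {fset nat}) : set nat :=
  range (stanley p A).

Definition modular_p_stanley (p N : nat) (X : set nat) : Prop :=
  exists2 B : {fset nat}, modular_p_free_set p N B & X = stanley_set p B.

Definition sumset (X Y : set nat) : set nat :=
  [set x + y | x in X & y in Y].

Definition dilate (c : nat) (X : set nat) : set nat :=
  [set c * x | x in X].

Lemma leastP (P : nat -> Prop) :
  (exists n, P n) -> P (least P) /\ forall m, P m -> least P <= m.
Proof.
move=> exP; apply: (@xgetPex _ 0 [set n | P n /\ forall m, P m -> n <= m]).
have exPb : exists n, `[< P n >] by case: exP => n Pn; exists n; apply/asboolP.
case: (ex_minnP exPb) => n /asboolP Pn minn_n; exists n; split=> // m Pm.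
by apply: minn_n; apply/asboolP.
Qed.

Lemma p_free_extend (p L : nat) (s : seq nat) :
  2 < p -> (forall y, y \in s -> y <= L) -> p_free p [set` s] ->
  p_free p [set` rcons s (L.*2.+1)].
Proof.
move=> p_gt2 leL sfree t d szt tin tap.
set x := L.*2.+1 in tin *.
have [xt|xNt] := boolP (x \in t); last first.
  apply: (sfree t) => // y yt; have := tin y yt.
  rewrite /= mem_rcons inE => /orP[/eqP yx|//].
  by rewrite -yx yt in xNt.
have bnd j : j < p -> nth 0 t j = x \/ nth 0 t j <= L.
  move=> jp; have /tin : nth 0 t j \in t by rewrite mem_nth ?szt.
  by rewrite /= mem_rcons inE => /orP[/eqP|/leL]; [left|right].
have [i ip xi] : exists2 i, i < p & nth 0 t i = x.
  by exists (index x t); rewrite ?nth_index // -szt index_mem.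
have eq_d j : j.+1 < p -> ((nth 0 t j.+1)%:Z - (nth 0 t j)%:Z)%R = d.
  by rewrite -szt; apply: tap.
have aux (a b c : nat) : a = x \/ a <= L -> b = x \/ b <= L ->
    c = x \/ c <= L -> a = x \/ b = x \/ c = x ->
    (b%:Z - a%:Z)%R = d -> (c%:Z - b%:Z)%R = d -> d = 0%R.
  by rewrite /x; lia.
have [j jp xj] : exists2 j, j.+2 < p &
    nth 0 t j = x \/ nth 0 t j.+1 = x \/ nth 0 t j.+2 = x.
  by case: i => [|[|i]] in ip xi *; [exists 0|exists 0|exists i]; tauto.
apply: (aux _ _ _ _ _ _ xj); [| | |exact: eq_d (ltnW jp)|exact: eq_d];
  by apply: bnd; lia.
Qed.

Lemma stanley_prefixE (p : nat) (A : {fset nat}) (n : nat) :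
  stanley_prefix p A n = [seq stanley p A i | i <- iota 0 n].
Proof.
elim: n => // n IHn; rewrite -addn1 iotaD map_cat -IHn add0n cats1 addn1 /=.
by rewrite /stanley /= last_rcons.
Qed.

Lemma stanley_init (p : nat) (A : {fset nat}) (i : nat) :
  i < #|` A| -> stanley p A i = nth 0 (sort leq A) i.
Proof. by move=> iA; rewrite /stanley /= iA last_rcons. Qed.

Lemma stanley_prefix_init (p : nat) (A : {fset nat}) :
  stanley_prefix p A #|` A| = sort leq A.
Proof.
rewrite stanley_prefixE; apply: (@eq_from_nth _ 0).
  by rewrite size_map size_iota size_sort.
move=> i; rewrite size_map size_iota => iA.
by rewrite (nth_map 0) ?size_iota // nth_iota // stanley_init.
Qed.

(* The greedy rule: for [n] at least the index of the largest element of [A],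
   the next term is the least admissible one. *)
Lemma stanleyP (p : nat) (A : {fset nat}) (n : nat) :
  2 < p -> 0 < #|` A| -> p_free p [set` A] -> #|` A| <= n.+1 ->
  let P x := stanley p A n < x /\
             p_free p (x |` [set stanley p A i | i in [set i | i <= n]]) in
  P (stanley p A n.+1) /\ forall x, P x -> stanley p A n.+1 <= x.
Proof.
move=> p_gt2 A_gt0 Afree leAn P.
pose Q m x := last 0 (stanley_prefix p A m) < x /\
              p_free p [set` rcons (stanley_prefix p A m) x].
have step m : #|` A| <= m ->
    p_free p [set` stanley_prefix p A m] ->
    {in stanley_prefix p A m,
      forall y, y <= last 0 (stanley_prefix p A m)} ->
    exists x, Q m x.
  move=> Am sfree leL; exists (last 0 (stanley_prefix p A m)).*2.+1; split.
    by lia.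
  exact: p_free_extend.
have inv m : #|` A| <= m ->
    p_free p [set` stanley_prefix p A m] /\
    {in stanley_prefix p A m,
      forall y, y <= last 0 (stanley_prefix p A m)}.
  elim: m => [|m IHm]; first by lia.
  rewrite leq_eqVlt => /orP[/eqP Am|]; last first.
    rewrite ltnS => Am; have [sfree leL] := IHm Am.
    have [[ltl free] _] := leastP (step m Am sfree leL).
    rewrite /= ltnNge Am /=; split; first exact: free.
    move=> y; rewrite last_rcons mem_rcons inE => /orP[/eqP-> //|/leL yl].
    exact: leq_trans yl (ltnW ltl).
  rewrite -Am stanley_prefix_init; split.
    move=> s d szs sA; apply: Afree => // x /sA /=.
    by rewrite mem_sort.
  move=> y yA; have := sort_sorted leq_total A.
  have : y \in sort leq A by [].
  elim/last_ind: (sort leq A) => // s z _.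
  rewrite last_rcons mem_rcons inE => /orP[/eqP-> //|ys].
  rewrite (sorted_pairwise leq_trans) pairwise_rcons => /andP[/allP + _].
  by move=> /(_ y ys).
have [sfree leL] := inv _ leAn.
have QP x : Q n.+1 x = P x.
  rewrite /Q /P -/(stanley p A n); congr (_ /\ p_free p _).
  have mems z : z \in stanley_prefix p A n.+1 <->
      exists2 i, i <= n & stanley p A i = z.
    rewrite stanley_prefixE; split=> [/mapP[i]|[i ile <-]].
      by rewrite mem_iota => /andP[_ ile] ->; exists i.
    by rewrite map_f // mem_iota.
  move: (stanley_prefix p A n.+1) mems => s mems.
  apply/seteqP; split=> y /=; rewrite mem_rcons inE.
    by case/orP => [/eqP->|/mems]; [left|right].
  by case=> [->|/mems ->]; rewrite ?eqxx ?orbT.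
have [] := leastP (step _ leAn sfree leL).
have -> : least (Q n.+1) = stanley p A n.+1.
  by rewrite [RHS]/stanley [in RHS]/= last_rcons ltnNge leAn.
by rewrite QP => ? mn; split=> // x; rewrite -QP; apply: mn.
Qed.

(* Main.v *)
Require Import Defs.
From mathcomp Require Import all_boot all_order all_algebra.
From mathcomp Require Import finmap boolp classical_sets zify.

Set Implicit Arguments.
Unset Strict Implicit.
Unset Printing Implicit Defensive.
Import GRing.Theory.

(** Why the theorem holds. The set [S_p(A)] is determined by three properties:
    it is [p]-free, it adds to [A] only numbers above [A], and every number
    above [A] that it omits is the last term of a progression whose other terms
    it contains. This is [stanley_greedy], and strong induction shows that no
    two sets share these properties ([greedy_extension_unique]). So the first
    formula amounts to checking them for [A + N S_p(0)]
    ([modular_greedy_extension]): write a number as [r + N q]; progressions are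
    analysed first modulo [N], then on the quotients, and coverings of [r] by
    [A] and of [q] by [S_p(0)] are added term by term.

    For the second formula the same two-level argument is carried out modulo
    [N M] ([modular_sumset_dilate]): if [A] is modular modulo [N] and [C]
    modulo [M], then so is [alpha A + N C] modulo [N M] as soon as it fits below
    [N M]. Since {0, .., p - 2} is modular modulo [p], this shows first that
    the set [D_l] of numbers below [p ^ l] with base [p] digits at most [p - 2]
    is modular modulo [p ^ l]; and the first formula gives
    [S_p(0) = D_l + p ^ l S_p(0)] ([stanley0_digits]). For large [l] the set
    [B = alpha A + N D_l] lies below [p ^ l N], hence is modular, and
    [S_p(B) = B + p ^ l N S_p(0) = alpha A + N (D_l + p ^ l S_p(0))
            = alpha A + N S_p(0)]. *)

(** * Greedy extensions *)

(** A decreasing progression is an increasing one read backwards, so natural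
    differences suffice. *)
Lemma p_freeP (p : nat) (X : set nat) : 1 < p ->
  p_free p X <-> (forall b d, (forall i, i < p -> X (b + d * i)) -> d = 0).
Proof.
move=> p_gt1; split=> [Xfree b d Xbd | Xfree s d sp sX sap].
  suff : Posz d = 0%R by case.
  apply: (Xfree (mkseq (fun i => b + d * i) p)); first by rewrite size_mkseq.
    by move=> x /mapP[i]; rewrite mem_iota => /andP[_ ip] ->; exact: Xbd.
  move=> i; rewrite size_mkseq => ip; rewrite !nth_mkseq //; last exact: ltnW.
  lia.
have sE i : i < p -> Posz (nth 0 s i) = (Posz (nth 0%N s 0) + d * Posz i)%R.
  elim: i => [|i IHi] ip; first by rewrite mulr0 addr0.
  have E : Posz (nth 0 s i.+1) = (Posz (nth 0%N s i) + d)%R.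
    have <- : (Posz (nth 0%N s i.+1) - Posz (nth 0%N s i))%R = d by apply: sap; rewrite sp.
    lia.
  by rewrite E (IHi (ltnW ip)) -addn1 PoszD mulrDr mulr1 addrA.
have Xs i : i < p -> X (nth 0 s i) by move=> ip; apply: sX; rewrite mem_nth ?sp.
case: d => d in sap sE *.
  rewrite (Xfree (nth 0 s 0) d) // => i ip.
  suff <- : nth 0 s i = nth 0 s 0 + d * i by exact: Xs.
  by have := sE i ip; lia.
suff : d.+1 = 0 by []; apply: (Xfree (nth 0 s p.-1)) => i ip.
suff <- : nth 0 s (p.-1 - i) = nth 0 s p.-1 + d.+1 * i by apply: Xs; lia.
have := sE (p.-1 - i); have := sE p.-1; nia.
Qed.

Definition covered (p : nat) (X : set nat) (x : nat) : Prop :=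
  exists b d, [/\ 0 < d, forall i, i < p.-1 -> X (b + d * i)
                & x = b + d * p.-1].

(** What the greedy rule says about the resulting set, without reference to an
    enumeration: beyond [A] a number is left out exactly when it completes a
    progression of smaller members. *)
Definition greedy_extension (p : nat) (A : {fset nat}) (X : set nat) : Prop :=
  [/\ forall a, a \in A -> X a,
      p_free p X,
      forall x, X x -> x \notin A -> {in A, forall a, a < x}
    & forall x, {in A, forall a, a < x} -> ~ X x -> covered p X x].

(** If [x] were outside [Y] it would complete a progression of smaller members
    of [Y]; these belong to [X] as well, and then so does the whole
    progression. *)
Lemma greedy_extension_sub (p : nat) (A : {fset nat}) (X Y : set nat) :
  1 < p -> greedy_extension p A X -> greedy_extension p A Y ->
  forall x, (forall y, y < x -> X y <-> Y y) -> X x -> Y x.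
Proof.
move=> p1 [_ Xfree Xabove _] [AY _ _ Ycov] x IH Xx.
have [/AY //|xA] := boolP (x \in A).
apply: contrapT => /(Ycov x (Xabove x Xx xA))[b [d [d0 Ybd xE]]].
suff : d = 0 by lia.
apply: ((p_freeP X p1).1 Xfree b) => i ip.
have [->|ip'] := eqVneq i p.-1; first by rewrite -xE.
have ltp : i < p.-1 by lia.
by apply/IH; [nia|exact: Ybd].
Qed.

Lemma greedy_extension_unique (p : nat) (A : {fset nat}) (X Y : set nat) :
  1 < p -> greedy_extension p A X -> greedy_extension p A Y -> X = Y.
Proof.
move=> p1 gX gY; apply/seteqP.
suff XY x : X x <-> Y x by split=> x /XY.
elim/ltn_ind: x => x IH; split; first exact: (greedy_extension_sub p1 gX gY).
by apply: (greedy_extension_sub p1 gY gX) => y /IH[].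
Qed.

(** * Stanley sequences as greedy extensions *)

Section Stanley.
Variables (p : nat) (A : {fset nat}).
Hypotheses (p2 : 2 < p) (A0 : 0 < #|` A|) (Afree : p_free p [set` A]).

Lemma stanley_lt m n : m < n -> stanley p A m < stanley p A n.
Proof.
suff inc i : stanley p A i < stanley p A i.+1.
  exact: (homo_ltn ltn_trans inc).
have [iA|Ai] := ltnP i.+1 #|` A|; last first.
  by have [[]] := stanleyP p2 A0 Afree Ai.
rewrite !stanley_init //; last exact: ltnW.
have su : sorted ltn (sort leq A).
  by rewrite ltn_sorted_uniq_leq sort_uniq fset_uniq sort_sorted //; exact: leq_total.
by apply: (sorted_ltn_nth ltn_trans) => //; rewrite inE size_sort // ltnW.
Qed.

Lemma stanley_lt_inv m n : stanley p A m < stanley p A n -> m < n.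
Proof.
rewrite !ltnNge; apply: contra; rewrite leq_eqVlt => /orP[/eqP-> //|].
by move/stanley_lt/ltnW.
Qed.

Lemma stanley_ge n : n <= stanley p A n.
Proof. by elim: n => // n IH; apply: leq_ltn_trans IH (stanley_lt _). Qed.

Lemma stanley_mem_init a : a \in A -> exists2 i, i < #|` A| & stanley p A i = a.
Proof.
move=> aA; exists (index a (sort leq A)).
  by rewrite -(size_sort leq) index_mem mem_sort.
rewrite stanley_init ?nth_index ?mem_sort //.
by rewrite -(size_sort leq) index_mem mem_sort.
Qed.

Lemma stanley_init_mem i : i < #|` A| -> stanley p A i \in A.
Proof. by move=> iA; rewrite stanley_init // -(mem_sort leq) mem_nth ?size_sort. Qed.

Lemma stanley_set_free : p_free p (stanley_set p A).
Proof.
apply/(p_freeP _ (ltnW p2)) => b d Xbd.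
have An : #|` A| <= (b + d * p + #|` A|).+1 by lia.
have [[_ free] _] := stanleyP p2 A0 Afree An.
apply: ((p_freeP _ (ltnW p2)).1 free b d) => i ip.
have [j _ jE] := Xbd i ip; right; exists j => //=.
have : b + d * i <= b + d * p by rewrite leq_add2l leq_mul2l ltnW ?orbT.
by rewrite -jE; have := stanley_ge j; lia.
Qed.

(** A number skipped by the sequence lies strictly between two consecutive
    terms [s n < x < s n.+1] with [n] past the initial segment. By minimality of
    [s n.+1], the number [x] together with the earlier terms contains a
    progression; it must end at [x], as [x] is the largest number in it and the
    other terms alone are [p]-free. *)
Lemma stanley_greedy : greedy_extension p A (stanley_set p A).
Proof.
split=> [a /stanley_mem_init[i _ <-]| |_ [i _ <-] iA a|x xA xX].
- by exists i.
- exact: stanley_set_free.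
- move=> /stanley_mem_init[j jA <-]; apply: stanley_lt; apply: (leq_trans jA).
  by rewrite leqNgt; apply: contra iA; exact: stanley_init_mem.
have exn : exists n, x < stanley p A n.
  by exists x.+1; apply: stanley_ge.
case: (ex_minnP exn) => -[|n] xn minn.
  by have := xA _ (stanley_init_mem A0); rewrite ltnNge ltnW.
have nx : stanley p A n < x.
  rewrite ltn_neqAle; apply/andP; split.
    by apply/eqP => nx; apply: xX; exists n.
  by rewrite leqNgt; apply/negP => /minn; rewrite ltnn.
have An : #|` A| <= n.+1.
  rewrite leqNgt; apply/negP => nA.
  by have := xA _ (stanley_init_mem nA); rewrite ltnNge ltnW.
have [_ /(_ x) least_n] := stanleyP p2 A0 Afree An.
have nfree : ~ p_free p (x |` [set stanley p A i | i in [set i | i <= n]])%classic.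
  by move=> free; have := least_n (conj nx free); rewrite leqNgt xn.
have [b [d [bdX d0]]] : exists b d, (forall i, i < p ->
    (x |` [set stanley p A i | i in [set i | i <= n]])%classic (b + d * i)) /\ d <> 0.
  apply: contrapT => nex; apply/nfree/(p_freeP _ (ltnW p2)) => b d bdX.
  by apply: contrapT => d0; apply: nex; exists b, d.
have mem_lt y : (x |` [set stanley p A i | i in [set i | i <= n]])%classic y ->
    y <= x /\ (y != x -> stanley_set p A y).
  case=> [->|[i /= ile <-]]; first by rewrite eqxx.
  split; last by exists i.
  apply: ltnW; apply: leq_ltn_trans nx; rewrite leqNgt.
  by apply/negP => /stanley_lt_inv; rewrite ltnNge ile.
have xE : x = b + d * p.-1.
  apply/eqP; apply: contrapT => /negP xN; apply: d0.
  have /mem_lt[lex _] : _ (b + d * p.-1) := bdX p.-1 ltac:(lia).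
  apply: ((p_freeP _ (ltnW p2)).1 stanley_set_free b) => i ip.
  have [_] := mem_lt _ (bdX i ip); apply; nia.
exists b, d; split=> [|i ip|//]; first lia.
have [_] := mem_lt _ (bdX i ltac:(lia)); apply; nia.
Qed.
End Stanley.

(** * Modular p-free sets and weak coverings *)

(** An integer difference can be reduced modulo [N] to a natural number. *)
Lemma is_ap_modP (N : nat) (s : seq nat) : 0 < N ->
  is_ap_mod N s <->
  exists d : nat, forall i, i < size s -> nth 0 s i = nth 0 s 0 + d * i %[mod N].
Proof.
move=> N0; split=> [[d sd]|[d sd]]; last first.
  exists (Posz d) => i ltis; apply/eqP; rewrite eqz_mod_dvd.
  have -> : (Posz (nth 0%N s i.+1) - Posz (nth 0%N s i) - Posz d =
             Posz (nth 0%N s i.+1) - Posz (nth 0%N s i + d)%N)%R by lia.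
  rewrite -eqz_mod_dvd !modz_nat; apply/eqP; congr Posz.
  by rewrite (sd _ ltis) -[RHS]modnDml (sd i (ltnW ltis)) modnDml mulnS [d + _]addnC addnA.
have d0 : (d %% N)%Z = Posz `|(d %% N)%Z|%N.
  by rewrite gez0_abs // modz_ge0 //; case: N N0 sd.
exists `|(d %% N)%Z|%N; elim=> [|i IHi] ltis; first by rewrite muln0 addn0.
rewrite mulnS addnCA -modnDmr -IHi ?(ltnW ltis) // modnDmr.
suff : (Posz (nth 0%N s i.+1) = Posz (`|(d %% N)%Z|%N + nth 0%N s i) %[mod N])%Z.
  by rewrite !modz_nat => -[].
rewrite PoszD -d0 modzDml; apply/eqP; rewrite eqz_mod_dvd.
have -> : (Posz (nth 0%N s i.+1) - (d + Posz (nth 0%N s i)) =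
           Posz (nth 0%N s i.+1) - Posz (nth 0%N s i) - d)%R by lia.
by rewrite -eqz_mod_dvd; apply/eqP/sd.
Qed.

(** [p_free_mod] with the terms given by a function and a natural difference,
    which spares the reindexing of sequences and the passage to integers. *)
Definition free_mod (p N : nat) (A : {fset nat}) : Prop :=
  forall (f : nat -> nat) (d : nat), (forall i, i < p -> f i \in A) ->
    (forall i, i < p -> f i = f 0 + d * i %[mod N]) ->
  forall i, i < p -> f i = f 0.

(** The difference [d] is allowed to vanish, so that members of [A] are weakly
    covered by constant progressions. The terms in [A] form a progression of
    natural numbers, not merely one modulo [N]. *)
Definition weakly_covered (p N : nat) (A : {fset nat}) (x : nat) : Prop :=
  exists b d, (forall i, i < p.-1 -> b + d * i \in A) /\
              x = b + d * p.-1 %[mod N].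

Lemma p_free_modP (p N : nat) (A : {fset nat}) : 0 < N ->
  p_free_mod p N A <-> free_mod p N A.
Proof.
move=> N0; split=> [Afree f d fA fd i ip | Afree s sp sA].
  have /(constantP 0)[c cE] : constant (mkseq f p).
    apply: Afree; first by rewrite size_mkseq.
      by move=> x /mapP[j]; rewrite mem_iota => /andP[_ jp] ->; exact: fA.
    apply/is_ap_modP => //; exists d => j; rewrite size_mkseq => jp.
    by rewrite !nth_mkseq ?(leq_ltn_trans _ jp) //; exact: fd.
  have fc j : j < p -> f j = c.
    by move=> jp; rewrite -(nth_mkseq 0 f jp) cE nth_nseq size_mkseq jp.
  by rewrite !fc // (leq_ltn_trans _ ip).
case/(is_ap_modP _ N0) => d sd; apply/(constantP 0); exists (nth 0 s 0).
apply: (@eq_from_nth _ 0); rewrite ?size_nseq // => i ip.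
rewrite nth_nseq ip; apply: (Afree (nth 0 s) d); rewrite -?sp //.
by move=> j jp; apply: sA; exact: mem_nth.
Qed.

(** The covering terms increase and lie in [0, N), so their consecutive
    differences lie in (0, N); being congruent to each other they are equal. *)
Lemma covered_mod_weakly (p N : nat) (A : {fset nat}) (x : nat) :
  2 < p -> 0 < N -> {in A, forall a, a < N} ->
  p_covered_mod p N A x -> weakly_covered p N A x.
Proof.
move=> p2 N0 AN [s [sp srt sA /(is_ap_modP _ N0)[d sd]]].
have sN i : i < p.-1 -> nth 0 s i < N by move=> ip; apply/AN/sA/mem_nth; rewrite sp.
pose e := nth 0 s 1 - nth 0 s 0.
have lt01 : nth 0 s 0 < nth 0 s 1.
  by apply: (sorted_ltn_nth ltn_trans) => //; rewrite inE sp; lia.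
have sE i : i < p.-1 -> nth 0 s i = nth 0 s 0 + d * i %[mod N].
  move=> ip; have := sd i; rewrite size_rcons sp !nth_rcons sp ip.
  by rewrite (leq_ltn_trans _ ip) // => ->; lia.
have ed : e = d %[mod N].
  apply/eqP; rewrite -(eqn_modDl (nth 0 s 0)) /e subnKC; last exact: ltnW.
  by rewrite sE ?muln1 //; lia.
exists (nth 0 s 0), e; split=> [i ip|]; last first.
  have := sd p.-1; rewrite size_rcons sp !nth_rcons sp ltnn eqxx => -> //.
  have -> : 0 < p.-1 by lia.
  by apply/eqP; rewrite eqn_modDl -modnMml -ed modnMml.
suff <- : nth 0 s i = nth 0 s 0 + e * i by apply/sA/mem_nth; rewrite sp.
elim: i ip => [|i IHi] ip; first by rewrite muln0 addn0.
have lti : nth 0 s i < nth 0 s i.+1.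
  by apply: (sorted_ltn_nth ltn_trans) => //; rewrite inE sp //; lia.
have : nth 0 s i.+1 - nth 0 s i = e %[mod N].
  apply/eqP; rewrite ed -(eqn_modDl (nth 0 s i)) subnKC; last exact: ltnW.
  by rewrite sE // mulnS addnCA addnC -modnDml -sE ?modnDml //; exact: ltnW.
have leq_sub (a b : nat) : a < N -> a - b < N by lia.
rewrite !modn_small; [|apply/leq_sub/sN; lia|exact/leq_sub/sN].
by rewrite mulnS -addnCA -IHi ?(ltnW ip) // => <-; rewrite subnK // ltnW.
Qed.

(** Members of [A] and numbers covered by [A] are treated alike on the right:
    a progression of difference 0 that weakly covers [x] can only be the
    constant one at [x], which requires [x] to be in [A]. *)
Lemma modular_p_free_setP (p N : nat) (A : {fset nat}) : 2 < p -> 0 < N ->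
  modular_p_free_set p N A <->
  [/\ 0 \in A, {in A, forall a, a < N}, free_mod p N A
    & forall x, x < N -> weakly_covered p N A x].
Proof.
move=> p2 N0; split=> -[A0 AN Afree Acov]; split=> //; try exact/p_free_modP.
  move=> x xN; have [xA|xA] := boolP (x \in A).
    by exists x, 0; split=> [i _|]; rewrite mul0n addn0.
  exact: covered_mod_weakly (Acov x xN xA).
move=> x xN xA; have [b [d [bdA xE]]] := Acov x xN.
have d0 : 0 < d.
  rewrite lt0n; apply: contra xA => /eqP d0; subst d.
  have bA : b \in A by have := bdA 0; rewrite mul0n addn0; apply; lia.
  by move: xE; rewrite mul0n addn0 !modn_small // => [->|] //; exact: AN.
exists (mkseq (fun i => b + d * i) p.-1); split.
- by rewrite size_mkseq.
- rewrite sorted_pairwise; last exact: ltn_trans.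
  apply/(pairwiseP 0) => i j; rewrite !inE size_mkseq => ip jp.
  by rewrite !nth_mkseq // => ij; rewrite /= ltn_add2l ltn_mul2l d0.
- by move=> y /mapP[i]; rewrite mem_iota => /andP[_ ip] ->; exact: bdA.
apply/is_ap_modP => //; exists d => i; rewrite size_rcons size_mkseq ltnS => ip.
rewrite !nth_rcons size_mkseq; have -> : 0 < p.-1 by lia.
rewrite (nth_mkseq _ _ (_ : 0 < p.-1)) ?muln0 ?addn0; last lia.
have [ip'|] := ltnP i p.-1; first by rewrite nth_mkseq.
move=> pi; have -> : i = p.-1 by lia.
by rewrite eqxx.
Qed.

(** * The Stanley sequence of a modular p-free set *)

Local Notation S0 p := (stanley_set p [fset 0]%fset).

Lemma mem_sumset_dilate (X Y : set nat) (c x : nat) :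
  sumset X (dilate c Y) x <-> exists a q, [/\ X a, Y q & x = a + c * q].
Proof.
split=> [[a Xa [_ [q Yq <-] <-]]|[a [q [Xa Yq ->]]]]; first by exists a, q.
by exists a => //; exists (c * q) => //; exists q.
Qed.

Lemma free_mod_p_free (p N : nat) (A : {fset nat}) : 1 < p ->
  free_mod p N A -> p_free p [set` A].
Proof.
move=> p1 Afree; apply/(p_freeP _ p1) => b d bdA.
have := Afree (fun i => b + d * i) d bdA _ 1 p1.
by rewrite muln0 addn0 => /(_ (fun _ _ => erefl)); lia.
Qed.

Lemma stanley0_greedy (p : nat) : 2 < p -> greedy_extension p [fset 0]%fset (S0 p).
Proof.
move=> p2; apply: stanley_greedy => //; first by rewrite cardfs1.
apply/p_freeP => [|b d bd0]; first lia.
have := bd0 1; have := bd0 0; rewrite /= !inE; lia.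
Qed.

Lemma stanley0_0 (p : nat) : 2 < p -> S0 p 0.
Proof. by move=> /stanley0_greedy[S00 _ _ _]; apply: S00; rewrite inE. Qed.

Lemma stanley0_cover (p x : nat) : 2 < p ->
  exists b d, (forall i, i < p.-1 -> S0 p (b + d * i)) /\ x = b + d * p.-1.
Proof.
move=> p2; have [Sx|nSx] := pselect (S0 p x).
  by exists x, 0; split=> [i _|]; rewrite mul0n addn0.
have [_ _ _ Scov] := stanley0_greedy p2.
have [a|b [d [_ bdS xE]]] := Scov x _ nSx; last by exists b, d.
rewrite inE => /eqP->; case: x nSx => // nS0.
by case: nS0; exact: stanley0_0.
Qed.

(** Freeness: modulo [N] a progression in [A + N S_p(0)] lies in [A], so it is
    constant there, and its quotients by [N] form a progression in [S_p(0)].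
    Covering of [x = r + N q]: [r] is weakly covered modulo [N] by a progression
    in [A] and [q] is weakly covered by one in [S_p(0)]; adding them term by term
    covers [x]. The first progression may overshoot and reach [r + N] instead
    of [r], in which case [q] is replaced by [q - 1]. *)
Lemma modular_greedy_extension (p N : nat) (A : {fset nat}) : 2 < p -> 0 < N ->
  modular_p_free_set p N A ->
  greedy_extension p A (sumset [set` A] (dilate N (S0 p)))%classic.
Proof.
move=> p2 N0 /(modular_p_free_setP _ p2 N0)[A0 AN Afree Acov].
have p1 := ltnW p2; have [_ Sfree _ _] := stanley0_greedy p2.
have AX a : a \in A -> (sumset [set` A] (dilate N (S0 p)))%classic a.
  move=> aA; apply/mem_sumset_dilate; exists a, 0.
  by split=> //; [exact: stanley0_0 | rewrite muln0 addn0].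
split=> //.
- apply/(p_freeP _ p1) => b d bdX.
  have modA i : i < p -> (b + d * i) %% N \in A /\ S0 p ((b + d * i) %/ N).
    move=> /bdX/mem_sumset_dilate[a [q [/= aA Sq ->]]].
    by rewrite addnC mulnC modnMDl divnMDl // modn_small ?divn_small ?AN ?addn0.
  have cst := Afree (fun i => (b + d * i) %% N) d (fun i ip => (modA i ip).1).
  have {}cst i : i < p -> (b + d * i) = b %[mod N].
    move=> ip; rewrite cst ?muln0 ?addn0 // => j jp.
    by rewrite modnDml modn_mod.
  have /dvdnP[e dE] : N %| d.
    by have /eqP := cst 1 p1; rewrite muln1 eqn_mod_dvd ?leq_addr // addKn.
  suff : e = 0 by rewrite dE => ->.
  apply: ((p_freeP _ p1).1 Sfree (b %/ N)) => i ip.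
  have := (modA i ip).2.
  by rewrite dE mulnAC addnC divnMDl // addnC.
- move=> x /mem_sumset_dilate[a [[|q] [/= aA Sq ->]]].
    by rewrite muln0 addn0 aA.
  by move=> _ a' /AN; rewrite mulnS; lia.
move=> x Ax nXx.
have [b [d [bdA rE]]] := Acov (x %% N) (ltn_pmod x N0).
pose y := b + d * p.-2.
have yA : y \in A by apply: bdA; lia.
have ydE : b + d * p.-1 = y + d.
  have -> : p.-1 = p.-2.+1 by lia.
  by rewrite mulnS /y; lia.
have dy : d <= y by apply: leq_trans (leq_addl _ _); apply: leq_pmulr; lia.
have yN : y < N := AN y yA.
(* Overshooting with [x < N] would give [x < y], as [d <= y < N], whereas [x]
   lies above all of [A]. *)
have [q xE] : exists q, x = b + d * p.-1 + N * q.
  have xE := divn_eq x N; move: rE; rewrite modn_mod => rE.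
  have [lt|ge] := ltnP (b + d * p.-1) N.
    by exists (x %/ N); rewrite {1}xE rE [in LHS]modn_small // addnC [_ * N]mulnC.
  have bdE : b + d * p.-1 = N + x %% N.
    have : b + d * p.-1 - N < N by lia.
    move/modn_small; rewrite -modnDl subnKC // -rE => ->; lia.
  have [q0|q0] := posnP (x %/ N); last first.
    exists (x %/ N).-1; rewrite bdE {1}xE -{1}(prednK q0); lia.
  by have := Ax y yA; rewrite xE q0; lia.
have [c [e [ceS qE]]] := stanley0_cover q p2.
have Xi i : i < p.-1 ->
    (sumset [set` A] (dilate N (S0 p)))%classic ((b + N * c) + (d + N * e) * i).
  move=> ip; apply/mem_sumset_dilate; exists (b + d * i), (c + e * i).
  by split; [exact: bdA|exact: ceS|lia].
exists (b + N * c), (d + N * e); split=> //; last by rewrite xE qE; lia.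
rewrite lt0n; apply/eqP => de0; apply: nXx.
have := Xi 0 ltac:(lia); rewrite de0.
suff -> : x = b + N * c + 0 * 0 by [].
by rewrite xE qE; nia.
Qed.

Lemma modular_stanley (p N : nat) (A : {fset nat}) : 2 < p -> 0 < N ->
  modular_p_free_set p N A ->
  stanley_set p A = (sumset [set` A] (dilate N (S0 p)))%classic.
Proof.
move=> p2 N0 Amod; have [A0 _ Afree _] := Amod.
apply: (@greedy_extension_unique p A); first exact: ltnW.
  apply: stanley_greedy => //; first by rewrite cardfs_gt0; apply/fset0Pn; exists 0.
  by apply: (@free_mod_p_free p N); [exact: ltnW | exact/p_free_modP].
exact: modular_greedy_extension.
Qed.

(** * Combining modular p-free sets *)

Lemma coprime_inverse (a N : nat) :
  coprime a N -> exists u, a * u = 1 %[mod N].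
Proof.
case: a => [|a] co; last first.
  have /(coprimeP _ (ltn0Sn a))[[u v] /= uvE] := co.
  exists u; have -> : a.+1 * u = v * N + 1 by lia.
  by rewrite modnMDl.
by exists 0; move: co; rewrite /coprime gcd0n => /eqP->; rewrite !modn1.
Qed.

(** Two levels of a mixed radix: a progression modulo [N M] in
    [alpha A + N C] is constant in its [A] part, since modulo [N] the factor
    [alpha] can be divided out, and then in its [C] part modulo [M]. Likewise
    weak coverings of the two parts add up to a weak covering of [x]. *)
Lemma modular_sumset_dilate (p M N alpha : nat) (A C B : {fset nat}) :
  2 < p -> 0 < M -> 0 < N -> coprime alpha N ->
  modular_p_free_set p N A -> modular_p_free_set p M C ->
  [set` B]%classic = sumset (dilate alpha [set` A]) (dilate N [set` C])%classic ->
  {in B, forall x, x < N * M} ->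
  modular_p_free_set p (N * M) B.
Proof.
move=> p2 M0 N0 co /(modular_p_free_setP _ p2 N0)[A0 AN Afree Acov].
move=> /(modular_p_free_setP _ p2 M0)[C0 CM Cfree Ccov] BE BNM.
have NM0 : 0 < N * M by rewrite muln_gt0 N0.
have BP x : x \in B <->
    exists a c, [/\ a \in A, c \in C & x = alpha * a + N * c].
  have -> : (x \in B : Prop) = [set` B]%classic x by [].
  rewrite BE; split=> [/mem_sumset_dilate|].
    by case=> _ [c [[a aA <-] cC ->]]; exists a, c.
  by case=> a [c [aA cC ->]]; apply/mem_sumset_dilate; exists (alpha * a), c;
     split=> //; exists a.
have p1 := ltnW p2.
have [u uE] := coprime_inverse co.
apply/(modular_p_free_setP _ p2 NM0); split=> //.
- by apply/BP; exists 0, 0; rewrite !muln0.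
- move=> f d fB fd.
  have /choice[a fa] : forall i, exists a, i < p ->
      exists c, [/\ a \in A, c \in C & f i = alpha * a + N * c].
    move=> i; have [/fB/BP[a [c H]]|_] := ltnP i p; last by exists 0.
    by exists a => _; exists c.
  have /choice[c fc] : forall i, exists c, i < p ->
      [/\ a i \in A, c \in C & f i = alpha * a i + N * c].
    move=> i; have [/fa[c H]|_] := ltnP i p; last by exists 0.
    by exists c.
  have p0 : 0 < p by lia.
  have [_ _ f0E] := fc 0 p0.
  have acst i : i < p -> a i = a 0.
    apply: (Afree a (u * d)) => j jp; first by have [] := fc j jp.
    have [_ _ fjE] := fc j jp.
    have := fd j jp; rewrite fjE f0E => /(congr1 (fun z => u * (z %% N) %% N)).
    rewrite !modn_dvdm ?dvdn_mulr // !modnMmr !mulnDr.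
    have uN z w : u * (alpha * z) + w = z + w %[mod N].
      by rewrite mulnA [u * _]mulnC -modnDml -modnMml uE modnMml modnDml mul1n.
    have uN' z w : u * (N * z) + w = w %[mod N] by rewrite mulnCA mulnC modnMDl.
    rewrite uN addnC uN' -addnA uN addnCA uN'.
    by rewrite mulnA.
  have fE i : i < p -> f i = alpha * a 0 + N * c i.
    by move=> ip; have [_ _ ->] := fc i ip; rewrite acst.
  have /dvdnP[e dE] : N %| d.
    have := fd 1 p1; rewrite !fE // muln1 -addnA => /eqP.
    rewrite eqn_modDl => /eqP/(congr1 (modn^~ N)).
    rewrite !modn_dvdm ?dvdn_mulr // -modnDml !modnMr add0n => /esym.
    by move/eqP.
  have ccst i : i < p -> c i = c 0.
    apply: (Cfree c e) => j jp; first by have [] := fc j jp.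
    have := fd j jp; rewrite !fE // -addnA => /eqP.
    rewrite eqn_modDl dE mulnAC -[_ * N]mulnC -mulnDr -!muln_modr eqn_pmul2l //.
    by move/eqP.
  by move=> i ip; rewrite !fE // ccst.
- move=> x xNM.
  have [b [d [bdA uxE]]] := Acov ((u * x) %% N) (ltn_pmod _ N0).
  pose y := alpha * (b + d * p.-1).
  have yx : y = x %[mod N].
    by rewrite /y -modnMmr -uxE modnMmr modnMmr mulnA -modnMml uE modnMml mul1n.
  (* Adding the multiple [N * M * y] only keeps the subtraction of [y] from
     being truncated. *)
  have /dvdnP[q qE] : N %| x + N * M * y - y.
    rewrite -eqn_mod_dvd ?(leq_trans _ (leq_addl _ _)) ?leq_pmull //.
    by rewrite -mulnA mulnC addnC modnMDl yx.
  have [c [e [ceC qcE]]] := Ccov (q %% M) (ltn_pmod _ M0).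
  exists (alpha * b + N * c), (alpha * d + N * e); split=> [i ip|].
    apply/BP; exists (b + d * i), (c + e * i); split; [exact: bdA|exact: ceC|lia].
  have -> : alpha * b + N * c + (alpha * d + N * e) * p.-1 =
     y + N * (c + e * p.-1) by rewrite /y; lia.
  have xyq : y * (N * M) + x = y + N * q.
    have yle : y <= x + N * M * y by rewrite (leq_trans _ (leq_addl _ _)) ?leq_pmull.
    by rewrite mulnC [RHS]addnC [N * q]mulnC -qE subnK // addnC.
  rewrite -(modnMDl y x) xyq; apply/eqP; rewrite eqn_modDl -!muln_modr.
  by rewrite -qcE modn_mod.
Qed.

(** * Base p digits and self-similarity *)

Definition digits (p : nat) : {fset nat} := [fset i | i in iota 0 p.-1]%fset.

Lemma in_digits (p x : nat) : (x \in digits p) = (x < p.-1).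
Proof. by rewrite in_fset /= mem_iota. Qed.

(** A difference prime to [p] makes [p] consecutive terms run through all
    residues, including the missing residue [p - 1]; and [p - 1] is covered by
    all the smaller numbers. *)
Lemma digits_modular (p : nat) : prime p -> 2 < p ->
  modular_p_free_set p p (digits p).
Proof.
move=> p_prime p2; have p0 := prime_gt0 p_prime.
apply/(modular_p_free_setP _ p2 p0); split=> [|x|f d fT fd i ip|x xp].
- by rewrite in_digits; lia.
- by rewrite in_digits; lia.
- have fp j : j < p -> f j < p.-1 by move=> jp; rewrite -in_digits fT.
  have [/dvdnP[e dE]|pd] := boolP (p %| d).
    have := fd i ip; rewrite dE mulnAC addnC modnMDl !modn_small //.
      by have := fp 0 p0; lia.
    by have := fp i ip; lia.
  have co : coprime d p by rewrite coprime_sym prime_coprime.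
  have [u uE] := coprime_inverse co.
  (* The index at which the progression would hit the residue [p - 1]. *)
  pose j := (u * (p.-1 - f 0)) %% p.
  have jp : j < p by rewrite ltn_pmod.
  have := fd j jp; rewrite -modnDmr modnMmr mulnA -modnMml uE modnMml mul1n.
  rewrite modnDmr subnKC; last by have := fp 0 p0; lia.
  have fjp := fp j jp; rewrite !modn_small; lia.
have [xT|xT] := ltnP x p.-1.
  by exists x, 0; split=> [i _|]; rewrite mul0n addn0 // in_digits.
exists 0, 1; split=> [i ip|]; first by rewrite in_digits mul1n.
have -> : x = p.-1 by lia.
by rewrite mul1n.
Qed.

(** The numbers below [p ^ l] whose base [p] digits are all at most [p - 2]. *)
Fixpoint digit_set (p l : nat) : {fset nat} :=
  if l is k.+1 then
    [fset (t + p * c)%N | t in digits p, c in digit_set p k]%fset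
  else [fset 0]%fset.

Lemma digit_setS p l x : x \in digit_set p l.+1 <->
  exists t c, [/\ t < p.-1, c \in digit_set p l & x = t + p * c].
Proof.
split=> [/imfset2P[t + [c /= cD ->]]|[t [c [tp cD ->]]]].
  by rewrite /= in_digits => tp; exists t, c.
by apply: in_imfset2; rewrite //= in_digits.
Qed.

(** The gap below [p ^ l] grows with [l]: it is what makes room for the
    factor [alpha] once [l] is large. *)
Lemma digit_set_lt p l x : 2 < p -> x \in digit_set p l -> x + l < p ^ l.
Proof.
move=> p2; elim: l x => [|l IHl] x; first by rewrite inE => /eqP->.
move=> /digit_setS[t [c [tp /IHl cl ->]]]; rewrite expnS.
have : p * (c + l).+1 <= p * p ^ l by rewrite leq_mul2l cl orbT.
nia.
Qed.

Lemma digit_set_modular p l : prime p -> 2 < p ->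
  modular_p_free_set p (p ^ l) (digit_set p l).
Proof.
move=> p_prime p2; have p0 := prime_gt0 p_prime.
elim: l => [|l IHl].
  apply/modular_p_free_setP => //; split=> [|x|f d f0 _ i ip|x].
  - by rewrite inE.
  - by rewrite inE => /eqP->.
  - have := f0 i ip; have := f0 0 p0; rewrite !inE => /eqP-> /eqP-> //.
  - rewrite expn0 ltnS leqn0 => /eqP->.
    by exists 0, 0; split=> // i _; rewrite inE.
rewrite expnS; apply: (modular_sumset_dilate (alpha := 1) p2 _ p0 _
  (digits_modular p_prime p2) IHl).
- by rewrite expn_gt0 p0.
- by rewrite coprime1n.
- apply/seteqP; split=> x.
    move=> /digit_setS[t [c [tp cD ->]]]; apply/mem_sumset_dilate.
    exists t, c; split=> //; exists t; rewrite ?mul1n //=.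
    by rewrite in_digits.
  move=> /mem_sumset_dilate[_ [c [[t /= tp <-] cD ->]]].
  apply/digit_setS; exists t, c; rewrite mul1n; split=> //.
  by move: tp; rewrite in_digits.
move=> x /(digit_set_lt p2); rewrite expnS; lia.
Qed.

(** The self-similarity [S_p(0) = {0, .., p - 2} + p S_p(0)]. The right-hand
    side is the greedy extension of {0, .., p - 2}; it is also the greedy
    extension of {0}, because the numbers up to [p - 2] are all in it and so
    leave nothing to be covered. *)
Lemma stanley0_rec p x : prime p -> 2 < p ->
  S0 p x <-> exists t q, [/\ t < p.-1, S0 p q & x = t + p * q].
Proof.
move=> p_prime p2; have p0 := prime_gt0 p_prime; have p1 := ltnW p2.
have Tmod := digits_modular p_prime p2.
have [TX Xfree Xabove Xcov] := modular_greedy_extension p2 p0 Tmod.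
have S0E : S0 p = sumset [set` digits p]%classic (dilate p (S0 p)).
  apply: (greedy_extension_unique p1 (stanley0_greedy p2)); split=> //.
  - by move=> a; rewrite inE => /eqP->; apply: TX; rewrite in_digits; lia.
  - by move=> y _; rewrite inE => y0 a; rewrite inE => /eqP->; lia.
  - move=> y _ nXy; apply: (Xcov) => // a; rewrite in_digits => ap.
    rewrite ltnNge; apply/negP => ya; apply: nXy; apply: TX.
    by rewrite in_digits (leq_ltn_trans ya).
rewrite {1}S0E mem_sumset_dilate; split=> -[t [q [tT Sq ->]]]; exists t, q; split=> //.
  by move: tT; rewrite /= in_digits.
by rewrite /= in_digits.
Qed.

Lemma stanley0_digits p l x : prime p -> 2 < p ->
  S0 p x <-> exists c q, [/\ c \in digit_set p l, S0 p q & x = c + p ^ l * q].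
Proof.
move=> p_prime p2; elim: l x => [|l IHl] x.
  split=> [Sx|[c [q [+ Sq ->]]]]; last by rewrite inE => /eqP->; rewrite mul1n.
  by exists 0, x; rewrite inE mul1n.
rewrite stanley0_rec //; split=> [[t [q [tp /IHl[c [r [cD Sr ->]]] ->]]]|].
  exists (t + p * c), r; split=> //; last by rewrite expnS; lia.
  by apply/digit_setS; exists t, c.
case=> _ [r [/digit_setS[t [c [tp cD ->]]] Sr ->]].
exists t, (c + p ^ l * r); split=> //; last by rewrite expnS; lia.
by apply/IHl; exists c, r.
Qed.

(** * Dilation by a number coprime to N *)

Theorem theorem6p5 (p N : nat) (A : {fset nat})
    (p_prime : prime p) (p_odd : odd p) (N_ge1 : 1 <= N)
    (A_lt_N : {in A, forall a, a < N})
    (A_0 : 0 \in A)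
    (A_free : p_free_mod p N A)
    (A_cover : forall x : nat, x < N -> x \notin A -> p_covered_mod p N A x) :
  stanley_set p A =
    sumset [set` A]%classic (dilate N (stanley_set p [fset 0]%fset))
  /\
  (forall alpha : nat, 1 <= alpha -> coprime alpha N ->
     exists l : nat,
       modular_p_stanley p (p ^ l * N)
         (sumset (dilate alpha [set` A]%classic)
                 (dilate N (stanley_set p [fset 0]%fset)))).
Proof.
have p2 : 2 < p by rewrite odd_prime_gt2.
have Amod : modular_p_free_set p N A by split.
split=> [|alpha alpha_gt0 co]; first exact: modular_stanley.
have pa0 : 0 < p ^ alpha by rewrite expn_gt0 prime_gt0.
(* [alpha] base [p] digits are enough: [alpha * a + N * c < p ^ alpha * N]
   follows from [a < N] and [c + alpha < p ^ alpha]. *)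
pose D := digit_set p alpha.
pose B := [fset (alpha * a + N * c)%N | a in A, c in D]%fset.
have BP x : x \in B <-> exists a c, [/\ a \in A, c \in D & x = alpha * a + N * c].
  split=> [/imfset2P[a aA [c cD ->]]|[a [c [aA cD ->]]]]; first by exists a, c.
  exact: in_imfset2.
have Bmod : modular_p_free_set p (p ^ alpha * N) B.
  rewrite mulnC; apply: (modular_sumset_dilate p2 pa0 N_ge1 co Amod).
  - exact: digit_set_modular.
  - apply/seteqP; split=> x.
      move=> /BP[a [c [aA cD ->]]]; apply/mem_sumset_dilate.
      by exists (alpha * a), c; split=> //; exists a.
    move=> /mem_sumset_dilate[_ [c [[a aA <-] cD ->]]].
    by apply/BP; exists a, c.
  - move=> x /BP[a [c [aA cD ->]]].
    have := digit_set_lt p2 cD; have := A_lt_N a aA; nia.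
exists alpha, B => //.
rewrite (modular_stanley p2 _ Bmod) ?muln_gt0 ?pa0 //.
apply/seteqP; split=> x /mem_sumset_dilate.
  move=> [_ [q [[a aA <-] /(stanley0_digits alpha _ p_prime p2)[c [r [cD Sr ->]]] ->]]].
  apply/mem_sumset_dilate; exists (alpha * a + N * c), r.
  by split; [apply/BP; exists a, c | | lia].
move=> [_ [r [/BP[a [c [aA cD ->]]] Sr ->]]].
apply/mem_sumset_dilate; exists (alpha * a), (c + p ^ alpha * r).
by split; [exists a | apply/(stanley0_digits alpha _ p_prime p2); exists c, r | lia].
Qed.
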